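(* Let $\mathbf{R}$ be a real closed field, let $a, b \in \mathbf{R}$ with $a < b$ and let $P, Q \in \mathbf{R}[X]$ with $P\neq 0$ and $\deg Q = q < \deg P = p$. If $(S_0, \dots, S_s)$ is the Sturm sequence of $P$ and $Q$, then $$ \mathrm{Ind}_a^b\Big(\frac{Q}{P}\Big) = \frac{1}{2}\sum_{0 \le i \le s-1} \left( \mathrm{sign}\Big( \frac{S_{i+1}}{S_{i}}, b \Big) - \mathrm{sign}\Big( \frac{S_{i+1}}{S_{i}}, a \Big) \right). $$
   Context: $\mathbf{R}$ is a real closed field; $\mathrm{sign}(y)\in\{-1,0,1\}$ is the sign of $y \in \mathbf{R}$. $Q=0$ is allowed (with $\deg 0=-\infty$). **Cauchy index.** Let $x\in\mathbf{R}$ and $F,G\in\mathbf{R}[X]\setminus\{0\}$. Write uniquely $\frac{G}{F} = (X-x)^m \frac{\widetilde G}{\widetilde F}$ with $m\in\mathbb{Z}$, $\widetilde F$ monic, $\widetilde F,\widetilde G \in \mathbf{R}[X]$ coprime, $\widetilde F(x)\neq 0$, $\widetilde G(x)\ne 0$. If $m<0$, set $\mathrm{Ind}_x^+(\frac GF)=\frac12\mathrm{sign}\big(\frac{\widetilde G(x)}{\widetilde F(x)}\big)$ and $\mathrm{Ind}_x^-(\frac GF)=\frac12(-1)^m\mathrm{sign}\big(\frac{\widetilde G(x)}{\widetilde F(x)}\big)$; if $m\ge 0$, both are $0$. Set $\mathrm{Ind}_x(\frac GF)=\mathrm{Ind}_x^+(\frac GF)-\mathrm{Ind}_x^-(\frac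 GF)$. For $a<b$ in $\mathbf{R}$, $$\mathrm{Ind}_a^b\Big(\frac GF\Big)=\mathrm{Ind}_a^+\Big(\frac GF\Big)+\sum_{x\in(a,b)}\mathrm{Ind}_x\Big(\frac GF\Big)-\mathrm{Ind}_b^-\Big(\frac GF\Big)$$ (only the finitely many roots of $F$ in $(a,b)$ contribute). If $G=0$, $\mathrm{Ind}_a^b(\frac GF)=0$. **Sign of a rational function at a point.** With the same notation, $\mathrm{sign}(\frac GF,x)=\mathrm{sign}(\widetilde G(x)\widetilde F(x))\in\{-1,1\}$ if $m=0$, and $\mathrm{sign}(\frac GF,x)=0$ if $m\neq0$. Also $\mathrm{sign}(\frac GF,x)=0$ if $G=0$. **Sturm sequence.** For $P\ne 0$ and $Q\neq0$: $S_0=P$, $S_1=Q$, $S_{i+1}=-\mathrm{Rem}(S_{i-1},S_i)$ (remainder of the Euclidean division of $S_{i-1}$ by $S_i$), and $s$ is the index such that $S_1,\dots,S_s\neq0$ and $S_{s+1}=0$; the Sturm sequence of $P$ and $Q$ is $(S_0,\dots,S_s)$. The Sturm sequence of $P$ and $0$ is $(S_0)=(P)$, with $s=0$. *)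

(* Defs.v *)
From HB Require Import structures.
From mathcomp Require Import all_boot all_order all_algebra.
From mathcomp Require Import polyorder polyrcf.
From mathcomp Require Import ring.

Set Implicit Arguments.
Unset Strict Implicit.
Unset Printing Implicit Defensive.

Import Order.TTheory GRing.Theory Num.Theory.

Local Open Scope ring_scope.
Local Notation "p %:F" := (tofrac p).

(* The triple t = (m, Gr, Fr) satisfies G / F = (X - x)^m * (Gr / Fr) in the *)
(* fraction field of {poly R}, with the normalisation making it unique.      *)
Definition is_local_form (R : rcfType) (x : R) (G F : {poly R})
    (t : int * {poly R} * {poly R}) : bool :=
  let: (m, Gr, Fr) := t in
  [&& G%:F / F%:F == ('X - x%:P)%:F ^ m * (Gr%:F / Fr%:F) :> {fraction {poly R}},
      Fr \is monic, coprimep Fr Gr, Fr.[x] != 0 & Gr.[x] != 0].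

Lemma mulf_divE (K : fieldType) (c d f g u v : K) :
  c != 0 -> d != 0 -> f != 0 -> v != 0 ->
  (g * d * u) / (f * d * v) = u / v * ((c * g) / (c * f)).
Proof. by move=> c0 d0 f0 v0; field; rewrite c0 d0 f0 v0. Qed.

Lemma divf_eqE (K : fieldType) (g1 f1 g2 f2 u : K) :
  f1 != 0 -> f2 != 0 -> g1 / f1 = u * (g2 / f2) -> g1 * f2 = u * g2 * f1.
Proof.
move=> f10 f20 e; rewrite -[g1](divfK f10) e -!mulrA.
by congr (_ * (_ * _)); rewrite mulrCA mulVf // mulr1.
Qed.

Lemma local_form_ex (R : rcfType) (x : R) (G F : {poly R}) :
  exists t, (G != 0) && (F != 0) ==> is_local_form x G F t.
Proof.
have [->|G0] := eqVneq G 0; first by exists (0, 0, 0).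
have [->|F0] /= := eqVneq F 0; first by exists (0, 0, 0).
have [g gx Ge] := mu_spec x G0; have [f fx Fe] := mu_spec x F0.
have f0 : f != 0 by apply: contraNneq fx => ->; rewrite root0.
pose d := gcdp f g; pose f1 := f %/ d; pose g1 := g %/ d.
have fE : f = f1 * d by rewrite divpK // dvdp_gcdl.
have gE : g = g1 * d by rewrite divpK // dvdp_gcdr.
have [f10 d0] : f1 != 0 /\ d != 0.
  by apply/andP; rewrite -negb_or -mulf_eq0 -fE.
have cop : coprimep f1 g1 by apply: coprimep_div_gcd; rewrite f0.
pose c := (lead_coef f1)^-1.
have c0 : c != 0 by rewrite invr_eq0 lead_coef_eq0.
exists ((\mu_x G)%:Z - (\mu_x F)%:Z, c *: g1, c *: f1) => /=.
have X0 : ('X - x%:P)%:F != 0 :> {fraction {poly R}}.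
  by rewrite tofrac_eq0 polyXsubC_eq0.
apply/and5P; split.
- rewrite expfzDr // -exprnN -exprnP -!mul_polyC !tofracM.
  rewrite [in G%:F]Ge [in F%:F]Fe fE gE !tofracM !tofracXn; apply/eqP.
  apply: mulf_divE.
  + by rewrite tofrac_eq0 polyC_eq0.
  + by rewrite tofrac_eq0.
  + by rewrite tofrac_eq0.
  + exact: expf_neq0 X0.
- by rewrite qualifE /= lead_coefZ mulVf // lead_coef_eq0.
- by rewrite coprimepZl // coprimepZr.
- rewrite hornerZ mulf_neq0 //.
  by apply: contraNneq fx => h; rewrite /root fE hornerM h mul0r.
- rewrite hornerZ mulf_neq0 //.
  by apply: contraNneq gx => h; rewrite /root gE hornerM h mul0r.
Qed.

Lemma local_form_unique (R : rcfType) (x : R) (G F : {poly R}) t1 t2 :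
  is_local_form x G F t1 -> is_local_form x G F t2 -> t1 = t2.
Proof.
move: t1 t2 => [[m1 G1] F1] [[m2 G2] F2].
wlog le12 : m1 m2 G1 G2 F1 F2 / m1 <= m2 => [hwlog h1 h2|].
  by case/orP: (le_total m1 m2) => le; [|apply: esym]; apply: hwlog.
case/and5P=> /eqP e1 mon1 cop1 f1 g1 /and5P[/eqP e2 mon2 cop2 f2 g2].
have X0 : ('X - x%:P)%:F != 0 :> {fraction {poly R}}.
  by rewrite tofrac_eq0 polyXsubC_eq0.
have F10 : F1%:F != 0 by rewrite tofrac_eq0 monic_neq0.
have F20 : F2%:F != 0 by rewrite tofrac_eq0 monic_neq0.
have [n nE] : exists n : nat, m2 = m1 + n%:Z.
  by exists `|m2 - m1|%N; rewrite gez0_abs ?subr_ge0 // addrCA subrr addr0.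
have E : G1 * F2 = ('X - x%:P) ^+ n * G2 * F1.
  apply/eqP; rewrite -tofrac_eq !tofracM tofracXn; apply/eqP.
  apply: (divf_eqE F10 F20); apply: (mulfI (expfz_neq0 m1 X0)).
  rewrite -e1 e2 nE expfzDr; last exact: X0.
  by rewrite -mulrA.
have n0 : n = 0%N.
  case: (n) E => // k /(congr1 (horner^~ x)) /eqP.
  rewrite !hornerM exprS hornerM hornerXsubC subrr !mul0r.
  by rewrite mulf_eq0 (negPf f2) (negPf g1).
move: E; rewrite nE n0 addr0 expr0 mul1r => E.
have e12 : F1 = F2.
  apply/eqP; rewrite -eqp_monic // /eqp; apply/andP; split.
    by rewrite -(Gauss_dvdpr _ cop1) E dvdp_mull.
  by rewrite -(Gauss_dvdpr _ cop2) -E dvdp_mull.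
by congr (_, _, _) => //; apply: (mulIf (monic_neq0 mon2)); rewrite E e12.
Qed.

(* The unique triple above; it is a junk value when G = 0 or F = 0.           *)
Definition local_form (R : rcfType) (x : R) (G F : {poly R}) :
    int * {poly R} * {poly R} :=
  xchoose (local_form_ex x G F).

Lemma local_formP (R : rcfType) (x : R) (G F : {poly R}) :
  G != 0 -> F != 0 -> is_local_form x G F (local_form x G F).
Proof.
move=> G0 F0; have /implyP := xchooseP (local_form_ex x G F).
by apply; rewrite G0 F0.
Qed.

(* Everywhere below, the numerator comes before the denominator. Indices are  *)
(* half-integers, hence take values in rat.                                   *)
Definition ind_right (R : rcfType) (x : R) (G F : {poly R}) : rat :=
  let: (m, Gr, Fr) := local_form x G F in
  if m < 0 then 2^-1 * (sgz (Gr.[x] / Fr.[x]))%:~R else 0.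

Definition ind_left (R : rcfType) (x : R) (G F : {poly R}) : rat :=
  let: (m, Gr, Fr) := local_form x G F in
  if m < 0 then 2^-1 * (-1) ^ m * (sgz (Gr.[x] / Fr.[x]))%:~R else 0.

Definition ind_at (R : rcfType) (x : R) (G F : {poly R}) : rat :=
  ind_right x G F - ind_left x G F.

Lemma ind_at_nroot (R : rcfType) (x : R) (G F : {poly R}) :
  G != 0 -> ~~ root F x -> ind_at x G F = 0.
Proof.
move=> G0 nrF; have F0 : F != 0 by apply: contraNneq nrF => ->; rewrite root0.
rewrite /ind_at /ind_right /ind_left; have := local_formP x G0 F0.
case: (local_form x G F) => [[m Gr] Fr] /and5P[/eqP e mon _ ftx gtx].
case: (ltP m 0) => [m0|]; last by rewrite subr0.
have X0 : ('X - x%:P)%:F != 0 :> {fraction {poly R}}.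
  by rewrite tofrac_eq0 polyXsubC_eq0.
have [k mE] : exists k : nat, m = - k.+1%:Z.
  by case: (m) m0 => // k _; exists k; rewrite NegzE.
have F'0 : F%:F != 0 by rewrite tofrac_eq0.
have Fr0 : Fr%:F != 0 by rewrite tofrac_eq0 monic_neq0.
have Xk0 : ('X - x%:P)%:F ^+ k.+1 != 0 := expf_neq0 _ X0.
have e' : Gr%:F / Fr%:F = ('X - x%:P)%:F ^+ k.+1 * (G%:F / F%:F).
  by rewrite e mE -exprnN (mulVKf Xk0).
have /eqP : Gr * F = ('X - x%:P) ^+ k.+1 * G * Fr.
  apply/eqP; rewrite -tofrac_eq !tofracM tofracXn; apply/eqP.
  exact: (divf_eqE Fr0 F'0 e').
rewrite -subr_eq0 => /eqP/(congr1 (horner^~ x))/eqP.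
rewrite hornerD hornerN !hornerM exprS hornerM hornerXsubC subrr !mul0r subr0.
by rewrite horner0 mulf_eq0 (negPf gtx) -[_ == 0]/(root F x) (negPf nrF).
Qed.

(* roots F a b lists the roots of F in the open interval (a, b); the other   *)
(* points of (a, b) contribute 0 by ind_at_nroot.                            *)
Definition cauchy_ind (R : rcfType) (a b : R) (G F : {poly R}) : rat :=
  if G == 0 then 0
  else ind_right a G F + \sum_(x <- roots F a b) ind_at x G F - ind_left b G F.

Definition sign_at (R : rcfType) (G F : {poly R}) (x : R) : int :=
  if G == 0 then 0 else
  let: (m, Gr, Fr) := local_form x G F in
  if m == 0 then sgz (Gr.[x] * Fr.[x]) else 0.

(* The Sturm sequence is (S 0, ..., S s); S s.+1 = 0 is only its stopping     *)
(* condition, and later values of S are irrelevant. For Q = 0 this forces     *)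
(* s = 0, so that the sequence is (P).                                        *)
Definition is_sturm_seq (R : rcfType) (P Q : {poly R})
    (S : nat -> {poly R}) (s : nat) : Prop :=
  [/\ S 0%N = P,
      S 1%N = Q,
      forall i, (i < s)%N -> S i.+2 = - (S i %% S i.+1),
      forall i, (1 <= i <= s)%N -> S i != 0
    & S s.+1 = 0].

Lemma sturm_seq_ex (R : rcfType) (P Q : {poly R}) :
  exists S s, is_sturm_seq P Q S s.
Proof.
have [n] := ubnP (size Q); elim: n P Q => // n IH P Q leQ.
rewrite ltnS in leQ; have [->|Q0] := eqVneq Q 0.
  exists (fun i => if i == 0%N then P else 0), 0%N; split=> // -[|i] //.
have [|S [s [S0 S1 Srec Snz Send]]] := IH Q (- (P %% Q)).
  by rewrite size_polyN (leq_trans _ leQ) // ltn_modpN0.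
exists (fun i => if i is j.+1 then S j else P), s.+1; split=> //.
- by case=> [|i] his; [rewrite S0 S1 | exact: Srec].
- by case=> [|[|i]] // his; [rewrite S0 | exact: Snz].
Qed.

Lemma sturm_seq_unique (R : rcfType) (P Q : {poly R}) S1 s1 S2 s2 :
  is_sturm_seq P Q S1 s1 -> is_sturm_seq P Q S2 s2 ->
  s1 = s2 /\ forall i, (i <= s1)%N -> S1 i = S2 i.
Proof.
wlog le12 : S1 s1 S2 s2 / (s1 <= s2)%N => [hwlog h1 h2|].
  have [le12|/ltnW le21] := leqP s1 s2; first exact: hwlog.
  by have [<- e] := hwlog _ _ _ _ le21 h2 h1; split=> // i /e.
case=> a0 a1 arec anz aend [b0 b1 brec bnz bend].
have e i : (i <= s1)%N -> S1 i = S2 i /\ S1 i.+1 = S2 i.+1.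
  elim: i => [|i IH] his; first by rewrite a0 a1 b0 b1.
  have [e1 e2] := IH (ltnW his).
  by rewrite arec // brec ?(leq_trans his) // e1 e2.
split=> [|i /e[]//]; apply/eqP; rewrite eqn_leq le12 /= leqNgt.
apply/negP => lt12; have := bnz s1.+1 lt12.
by rewrite -(e _ (leqnn s1)).2 aend eqxx.
Qed.

(* Main.v *)
Require Import Defs.
From mathcomp Require Import all_boot all_order all_algebra.
From mathcomp Require Import polyorder polyrcf.
From mathcomp Require Import zify ring.

Set Implicit Arguments.
Unset Strict Implicit.
Unset Printing Implicit Defensive.

Import Order.TTheory GRing.Theory Num.Theory.

Local Open Scope ring_scope.

(** The Sturm sequence runs Euclid's algorithm, and each of its steps has a
    known effect on the Cauchy index.

    Replacing G by a polynomial H with G + H divisible by F changes the sign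
    of the polar part of G/F and adds a polynomial, which has no poles; so the
    index is negated ([cauchy_ind_opposite_mod]).

    Exchanging numerator and denominator obeys an inversion formula
    ([cauchy_ind_inv]): the indices of G/F and F/G add up to half the variation
    of the sign of G/F between a and b. Indeed G/F, F/G and GF have the same
    sign wherever GF does not vanish, and every x that is a zero or a pole of
    G/F is a pole of exactly one of G/F and F/G, so that together the two
    indices record at x half the jump of the sign of GF across x. If x is
    neither, both indices vanish at x, and so does the jump, because GF then
    has even multiplicity at x. Since GF has constant sign between two
    consecutive roots, all the jumps in (a, b) add up to the difference
    of the one-sided signs at b and at a ([sign_jumps_sum]); at the two end
    points, the one-sided sign of GF is compensated by the one-sided index,
    except when G/F has neither a zero nor a pole there, and this leaves
    exactly the sign of G/F at b and at a.

    Combining both, Ind(S1/S0) is half the sign variation of S1/S0 minus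
    Ind(S0/S1), and - Ind(S0/S1) = Ind(S2/S1); the theorem follows by induction
    on the length of the sequence.

    All local data are expressed through root multiplicities and through the
    signs of a polynomial immediately to the right and to the left of x; the
    former turn products into sums and the latter are multiplicative, so the
    reduced fraction used to define the indices disappears from the argument
    after [local_formE]. *)

(** * One-sided signs of a polynomial *)

Definition right_sign {R : rcfType} (x : R) (H : {poly R}) : int :=
  sgz (sgp_right H x).

(** Crossing x changes the sign exactly when x is a root of odd multiplicity;
    [sgr_neighpl] shows that this is the sign at the points just before x. *)
Definition left_sign {R : rcfType} (x : R) (H : {poly R}) : int :=
  (-1) ^+ odd (\mu_x H) * right_sign x H.

Lemma right_signM (R : rcfType) (x : R) (G F : {poly R}) :
  right_sign x (G * F) = right_sign x G * right_sign x F.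
Proof. by rewrite /right_sign sgp_right_mul sgzM. Qed.

Lemma right_signN (R : rcfType) (x : R) (H : {poly R}) :
  right_sign x (- H) = - right_sign x H.
Proof. by rewrite -scaleN1r /right_sign sgp_right_scale sgrN1 mulN1r sgzN. Qed.

Lemma right_sign_sqr (R : rcfType) (x : R) (H : {poly R}) :
  H != 0 -> right_sign x H * right_sign x H = 1.
Proof. by move=> H0; rewrite -sgzM sgp_right_square // sgz1. Qed.

Lemma right_sign_nroot (R : rcfType) (x : R) (H : {poly R}) :
  ~~ root H x -> right_sign x H = sgz H.[x].
Proof. by move=> nr; rewrite /right_sign sgp_rightNroot // sgz_sgr. Qed.

(** Both signs are read off at points inside the interval, where the
    intermediate value theorem forbids a change of sign. *)
Lemma right_sign_eq_left (R : rcfType) (a b : R) (H : {poly R}) :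
  a < b -> {in `]a, b[, forall x, ~~ root H x} ->
  right_sign a H = left_sign b H.
Proof.
move=> ltab nr; have [->|H0] := eqVneq H 0.
  by rewrite /left_sign /right_sign !sgp_right0 sgz0 mulr0.
have [y yP] := neighpr_wit ltab H0; have [z zP] := neighpl_wit ltab H0.
have yab : y \in `]a, b[.
  move: yP (next_root_in H a b); rewrite max_l ?(ltW ltab) // !in_itv /=.
  by case/andP=> -> ltyn /andP[_] /(lt_le_trans ltyn).
have zab : z \in `]a, b[.
  move: zP (prev_root_in H a b); rewrite min_l ?(ltW ltab) // !in_itv /=.
  by case/andP=> ltnz -> /andP[/le_lt_trans->].
have := polyrN0_itv nr zab yab.
rewrite (sgr_neighpr yP) (sgr_neighpl zP) /left_sign /right_sign => ->.
by rewrite sgzM; case: odd; rewrite ?sgzN ?sgz1.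
Qed.

(** The sum telescopes: the sign on the right of a root is the sign on the
    left of the next one. *)
Lemma sign_jumps_sum (R : rcfType) (a b : R) (H : {poly R}) :
    a < b -> H != 0 ->
  right_sign a H + \sum_(x <- roots H a b) (right_sign x H - left_sign x H)
    - left_sign b H = 0.
Proof.
move=> ltab H0; have [n] := ubnP (size (roots H a b)).
elim: n a ltab => // n IH a ltab; case E: (roots H a b) => [|x s] lt.
  rewrite big_nil addr0 (right_sign_eq_left ltab) ?subrr //.
  by move=> y; exact: (roots_nil H0 E).
move/eqP: E; rewrite roots_cons => /and5P[_ xab /eqP r0 rx /eqP sE].
rewrite big_cons -sE (@right_sign_eq_left _ a x).
- rewrite sE -[RHS](IH x) ?sE ?(itvP xab) //; ring.
- by rewrite (itvP xab).
- by move=> y; exact: (roots_nil H0 r0).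
Qed.

(** * The local indices and signs in terms of one-sided signs *)

Lemma cross_mul (K : fieldType) (f g p q u v : K) :
    f != 0 -> q != 0 -> v != 0 -> g / f = (p / q) * (u / v) ->
  q * (g * v) = p * (u * f).
Proof.
move=> f0 q0 v0 e; rewrite -[g](divfK f0) e; field.
by rewrite q0 v0.
Qed.

(** The reduced numerator and denominator do not vanish at x, and cross
    multiplication gives an equality of polynomials in which powers of X - x
    are the only factors besides these two, F and G; the powers are positive on
    the right of x. Comparing multiplicities gives the exponent, comparing
    right signs gives the sign. *)
Lemma local_formE (R : rcfType) (x : R) (G F : {poly R}) :
    G != 0 -> F != 0 ->
  let: (m, Gr, Fr) := local_form x G F in
  m = (\mu_x G)%:Z - (\mu_x F)%:Z
  /\ sgz (Gr.[x] * Fr.[x]) = right_sign x (G * F).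
Proof.
move=> G0 F0; have := local_formP x G0 F0.
case: (local_form x G F) => [[m Gr] Fr] /and5P[/eqP e mon _ fx gx].
have X0 : tofrac ('X - x%:P) != 0 by rewrite tofrac_eq0 polyXsubC_eq0.
have Fr0 := monic_neq0 mon.
have Gr0 : Gr != 0 by apply: contraNneq gx => ->; rewrite horner0.
have [k [l mE]] : exists k l : nat, m = l%:Z - k%:Z.
  case: m {e} => n; first by exists 0%N, n; rewrite subr0.
  by exists n.+1, 0%N; rewrite NegzE sub0r.
have E : ('X - x%:P) ^+ k * (G * Fr) = ('X - x%:P) ^+ l * (Gr * F).
  apply/eqP; rewrite -tofrac_eq !tofracM !tofracXn; apply/eqP.
  apply: cross_mul; first by rewrite tofrac_eq0.
  - by apply: expf_neq0.
  - by rewrite tofrac_eq0.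
  by rewrite e mE expfzDr // -exprnN -exprnP.
have muX n : \mu_x (('X - x%:P) ^+ n) = n by rewrite mu_exp mu_XsubC mul1n.
have Xn0 n : ('X - x%:P) ^+ n != 0 by rewrite expf_neq0 // polyXsubC_eq0.
have sX n : right_sign x (('X - x%:P) ^+ n) = 1.
  elim: n => [|n IH].
    by rewrite right_sign_nroot ?rootC ?oner_neq0 // hornerC sgz1.
  rewrite exprS right_signM IH mulr1 /right_sign sgp_right_deriv ?root_XsubC //.
  by rewrite derivXsubC sgp_rightc sgr1 sgz1.
split.
  have := congr1 (multiplicity x) E; rewrite !mu_mul ?mulf_neq0 // !muX.
  rewrite (muNroot fx) (muNroot gx) addn0 add0n mE => /(congr1 Posz).
  by rewrite !PoszD => h; lia.
have := congr1 (right_sign x) E; rewrite !right_signM !sX !mul1r.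
rewrite sgzM -!right_sign_nroot // => h.
rewrite -[right_sign x Gr]mulr1 -(right_sign_sqr x F0) mulrA -h.
by rewrite -[RHS]mulr1 -(right_sign_sqr x Fr0); ring.
Qed.

Lemma sgz_div (R : realFieldType) (u v : R) : sgz (u / v) = sgz (u * v).
Proof. by rewrite !sgzM; congr (_ * _); rewrite !sgz_def invr_lt0 invr_eq0. Qed.

Lemma ind_rightE (R : rcfType) (x : R) (G F : {poly R}) :
    G != 0 -> F != 0 ->
  ind_right x G F =
    if (\mu_x G < \mu_x F)%N then 2^-1 * (right_sign x (G * F))%:~R else 0.
Proof.
move=> G0 F0; rewrite /ind_right; have := local_formE x G0 F0.
case: (local_form x G F) => [[m Gr] Fr] [-> <-].
by rewrite sgz_div subr_lt0 ltz_nat.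
Qed.

(** The exponent m is the difference of two multiplicities and the multiplicity
    of GF is their sum, so (-1)^m is the sign that turns the right sign of GF
    into its left sign. *)
Lemma ind_leftE (R : rcfType) (x : R) (G F : {poly R}) :
    G != 0 -> F != 0 ->
  ind_left x G F =
    if (\mu_x G < \mu_x F)%N then 2^-1 * (left_sign x (G * F))%:~R else 0.
Proof.
move=> G0 F0; rewrite /ind_left /left_sign; have := local_formE x G0 F0.
case: (local_form x G F) => [[m Gr] Fr] [-> <-].
rewrite sgz_div subr_lt0 ltz_nat mu_mul ?mulf_neq0 //; case: ltnP => // lt.
rewrite -opprB subzn ?(ltnW lt) // -exprnN -[(-1) ^+ (_ - _)]signr_odd.
rewrite oddB ?(ltnW lt) // addbC -oddD -mulrA; congr (_ * _).
by rewrite rmorphM rmorphXn /= rmorphN1 -exprVn invrN1.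
Qed.

Lemma sign_atE (R : rcfType) (x : R) (G F : {poly R}) :
    G != 0 -> F != 0 ->
  sign_at G F x = if \mu_x G == \mu_x F then right_sign x (G * F) else 0.
Proof.
move=> G0 F0; rewrite /sign_at (negPf G0).
have := local_formE x G0 F0.
case: (local_form x G F) => [[m Gr] Fr] [-> <-].
by rewrite subr_eq0 eqz_nat.
Qed.

(** Exactly one of G/F and F/G has a pole at x, unless the multiplicities of
    F and G agree; in that case [sign_at] takes the place of the indices. *)
Lemma ind_right_inv (R : rcfType) (x : R) (G F : {poly R}) :
    G != 0 -> F != 0 ->
  ind_right x G F + ind_right x F G
  = 2^-1 * (right_sign x (G * F) - sign_at G F x)%:~R.
Proof.
move=> G0 F0; rewrite !ind_rightE // sign_atE // [F * G]mulrC.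
by case: ltngtP; rewrite ?subr0 ?subrr ?addr0 ?add0r ?mulr0.
Qed.

(** As for [ind_right_inv]; when the multiplicities of F and G agree, their sum
    is even, hence the left and right signs of GF coincide. *)
Lemma ind_left_inv (R : rcfType) (x : R) (G F : {poly R}) :
    G != 0 -> F != 0 ->
  ind_left x G F + ind_left x F G
  = 2^-1 * (left_sign x (G * F) - sign_at G F x)%:~R.
Proof.
move=> G0 F0; rewrite !ind_leftE // sign_atE // [F * G]mulrC.
case: ltngtP => [_|_|e]; rewrite ?subr0 ?addr0 ?add0r //.
by rewrite /left_sign mu_mul ?mulf_neq0 // e addnn odd_double mul1r subrr mulr0.
Qed.

(** * The inversion formula *)

(** The points that are not poles contribute nothing, so the roots of F may be
    replaced by those of any multiple of F. This allows the indices of G/F and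
    F/G to be summed over the same list, the roots of GF. *)
Lemma cauchy_ind_roots (R : rcfType) (a b : R) (G F H : {poly R}) :
    G != 0 -> H != 0 -> F %| H ->
  cauchy_ind a b G F =
  ind_right a G F + \sum_(x <- roots H a b) ind_at x G F - ind_left b G F.
Proof.
move=> G0 H0 FH; rewrite /cauchy_ind (negPf G0).
have F0 : F != 0 by apply: contraNneq H0 => F0; rewrite F0 dvd0p in FH.
congr (_ + _ - _).
rewrite [RHS](bigID (root F)) /= [X in _ + X]big1 ?addr0; last first.
  by move=> x; apply: ind_at_nroot.
rewrite -[RHS]big_filter; apply: perm_big; apply: uniq_perm.
- exact: uniq_roots.
- by rewrite filter_uniq // uniq_roots.
move=> x; rewrite mem_filter !in_roots F0 H0 !andbT.
case rx: (root F x) => //=.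
by rewrite (root_dvdp FH).
Qed.

(** The inversion formula: adding the local identities [ind_right_inv] and
    [ind_left_inv] over the end points and the roots of GF makes the one-sided
    signs cancel by [sign_jumps_sum]. *)
Lemma cauchy_ind_inv (R : rcfType) (a b : R) (G F : {poly R}) :
    a < b -> G != 0 -> F != 0 ->
  cauchy_ind a b G F + cauchy_ind a b F G
  = 2^-1 * (sign_at G F b - sign_at G F a)%:~R.
Proof.
move=> ltab G0 F0; have GF0 : G * F != 0 by rewrite mulf_neq0.
rewrite (@cauchy_ind_roots _ _ _ G F (G * F)) ?dvdp_mull //.
rewrite (@cauchy_ind_roots _ _ _ F G (G * F)) ?dvdp_mulr //.
have jumps : \sum_(x <- roots (G * F) a b) ind_at x G F
    + \sum_(x <- roots (G * F) a b) ind_at x F G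
    = 2^-1 * (\sum_(x <- roots (G * F) a b)
        (right_sign x (G * F) - left_sign x (G * F)))%:~R.
  rewrite -big_split rmorph_sum mulr_sumr; apply: eq_bigr => x _ /=.
  rewrite /ind_at addrACA -opprD ind_right_inv // ind_left_inv //.
  by rewrite -mulrBr -rmorphB opprB addrA subrK.
rewrite addrACA -opprD addrACA jumps ind_right_inv // ind_left_inv //.
rewrite -mulrDr -mulrBr -rmorphD -rmorphB; congr (_ * _%:~R).
by move: (sign_jumps_sum ltab GF0); set t := \sum_(_ <- _) _; lia.
Qed.

(** * Reduction modulo the denominator *)

(** H is - G up to a multiple of F, which vanishes at x to a higher order
    than G does and so does not affect the leading behaviour at x. *)
Lemma mu_opposite_mod (R : rcfType) (x : R) (F G H : {poly R}) :
    G != 0 -> F %| G + H -> (\mu_x G < \mu_x F)%N ->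
  \mu_x H = \mu_x G /\ right_sign x H = - right_sign x G.
Proof.
move=> G0 FGH lt; have -> : H = (G + H) + - G by ring.
have NG0 : - G != 0 by rewrite oppr_eq0.
have [->|D0] := eqVneq (G + H) 0; first by rewrite add0r mu_opp right_signN.
have lt' : (\mu_x (- G) < \mu_x (G + H))%N.
  rewrite mu_opp (leq_trans lt) // -root_le_mu //.
  exact: dvdp_trans (root_mu _ _) FGH.
by rewrite mu_addl // mu_opp -right_signN /right_sign sgp_right_addp0.
Qed.

Lemma ind_opposite_mod (R : rcfType) (x : R) (F G H : {poly R}) :
    F != 0 -> G != 0 -> H != 0 -> F %| G + H ->
  ind_right x H F = - ind_right x G F /\ ind_left x H F = - ind_left x G F.
Proof.
move=> F0 G0 H0 FGH; rewrite !ind_rightE ?ind_leftE //.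
have [lt|le] := ltnP (\mu_x G) (\mu_x F).
  have [muH sH] := mu_opposite_mod G0 FGH lt.
  rewrite muH lt /left_sign !mu_mul ?mulf_neq0 // muH !right_signM sH.
  by rewrite !mulNr !mulrN !rmorphN !mulrN.
case: ltnP => [lt|]; last by rewrite oppr0.
rewrite addrC in FGH; have [muG _] := mu_opposite_mod H0 FGH lt.
by move: lt; rewrite -muG ltnNge le.
Qed.

(** The quotient G/F is then a polynomial and has no pole. *)
Lemma cauchy_ind_dvdp (R : rcfType) (a b : R) (G F : {poly R}) :
  F != 0 -> F %| G -> cauchy_ind a b G F = 0.
Proof.
move=> F0 FG; rewrite /cauchy_ind; case: eqVneq => // G0.
have le x : (\mu_x F <= \mu_x G)%N.
  by rewrite -root_le_mu // (dvdp_trans (root_mu _ _) FG).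
have [indr indl] : (forall x, ind_right x G F = 0)
    /\ forall x, ind_left x G F = 0.
  by split=> x; rewrite ?ind_rightE ?ind_leftE // ltnNge le.
rewrite indr indl big1 ?subrr ?addr0 // => x _.
by rewrite /ind_at indr indl subrr.
Qed.

(** Applied with H the opposite of the remainder of G by F, this is the effect
    on the index of one step of the Sturm sequence. *)
Lemma cauchy_ind_opposite_mod (R : rcfType) (a b : R) (F G H : {poly R}) :
  F != 0 -> F %| G + H -> cauchy_ind a b H F = - cauchy_ind a b G F.
Proof.
move=> F0 FGH.
have [G0|G0] := eqVneq G 0.
  by rewrite !cauchy_ind_dvdp ?oppr0 // ?G0 ?dvdp0 // -[H]add0r -G0.
have [H0|H0] := eqVneq H 0.
  by rewrite !cauchy_ind_dvdp ?oppr0 // ?H0 ?dvdp0 // -[G]addr0 -H0.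
rewrite /cauchy_ind (negPf G0) (negPf H0).
have [indr indl] : (forall x, ind_right x H F = - ind_right x G F)
    /\ forall x, ind_left x H F = - ind_left x G F.
  by split=> x; have [] := ind_opposite_mod x F0 G0 H0 FGH.
rewrite indr indl !opprD; congr (_ + _ + _).
rewrite -sumrN; apply: eq_bigr => x _.
by rewrite /ind_at indr indl opprD.
Qed.

(** * Induction along the Sturm sequence *)

Lemma is_sturm_seq_behead (R : rcfType) (P Q : {poly R}) S s :
  is_sturm_seq P Q S s.+1 ->
  [/\ Q != 0, Q %| P + S 2%N & is_sturm_seq Q (S 2%N) (S \o succn) s].
Proof.
case=> S0 S1 Srec Snz Send; split.
- by rewrite -S1 Snz.
- rewrite Srec // S0 S1 {1}(divp_eq P Q) -addrA subrr addr0.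
  exact: dvdp_mulIr.
- split=> //= i; first exact: (Srec i.+1).
  by case/andP=> i0 le; apply: Snz.
Qed.

Theorem theorem6 (R : rcfType) (a b : R) (P Q : {poly R})
    (S : nat -> {poly R}) (s : nat) :
  a < b -> P != 0 -> (size Q < size P)%N ->
  is_sturm_seq P Q S s ->
  cauchy_ind a b Q P
  = 2^-1 * \sum_(0 <= i < s)
      (sign_at (S i.+1) (S i) b - sign_at (S i.+1) (S i) a)%:~R.
Proof.
move=> ltab P0 _; elim: s P Q S P0 => [|s IH] P Q S P0 sturm.
  by case: sturm => _ <- _ _ ->; rewrite /cauchy_ind eqxx big_nil mulr0.
have [Q0 QP sturm'] := is_sturm_seq_behead sturm; case: sturm => S0 S1 _ _ _.
rewrite big_nat_recl //= mulrDr S0 S1 -cauchy_ind_inv //.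
rewrite -(IH _ _ _ Q0 sturm') (cauchy_ind_opposite_mod _ _ Q0 QP).
by rewrite addrK.
Qed.
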